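(* Let $m,n\ge1$. If $A\in\mathbb{C}^{m\times n}$ is a Cauchy matrix, then the Recovery Algorithm (given in the context) applied to $A$ yields normalized Cauchy points $\tilde s\in\mathbb{C}^m$, $\tilde t\in\mathbb{C}^n$ for $A$, in particular $A=C(\tilde s,\tilde t)$, in $\mathcal{O}(m+n)$ operations. Moreover, for any matrix $A\in\mathbb{C}^{m\times n}$ it can be decided in $\mathcal{O}(mn)$ operations whether $A$ is a Cauchy matrix.
   Context: Vectors $s\in\mathbb{C}^m$, $t\in\mathbb{C}^n$ are called Cauchy points if $s_i-t_j\neq 0$ for all $i,j$; they define the Cauchy matrix $C(s,t)=\left[\frac{1}{s_i-t_j}\right]\in\mathbb{C}^{m\times n}$. A matrix $A\in\mathbb{C}^{m\times n}$ is a Cauchy matrix if $A=C(s,t)$ for some Cauchy points $s,t$. For a Cauchy matrix $A$, vectors $\tilde s\in\mathbb{C}^m,\tilde t\in\mathbb{C}^n$ are called normalized Cauchy points for $A$ if $A=C(\tilde s,\tilde t)$ and $\left\|\begin{bmatrix}\tilde s\\ \tilde t\end{bmatrix}\right\|_2$ is minimal among all Cauchy points $s\in\mathbb{C}^m,t\in\mathbb{C}^n$ with $A=C(s,t)$. Recovery Algorithm. Input: a Cauchy matrix $A=[a_{ij}]\in\mathbb{C}^{m\times n}$ (so all $a_{ij}\ne0$). Steps: (1) $s_1:=0$; (2) $t_j:=s_1-1/a_{1j}$ for $j=1,\dots,n$; (3) $s_i:=t_1+1/a_{i1}$ for $i=2,\dots,m$; (4) $\alpha_*:=\frac{1}{m+n}\left(\sum_{i=1}^m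 s_i+\sum_{j=1}^n t_j\right)$; (5) $\tilde s:=s-\alpha_*1_m$, $\tilde t:=t-\alpha_*1_n$, where $1_k$ is the all-ones vector of length $k$. Output: $\tilde s,\tilde t$. An operation is an arithmetic operation ($+,-,\times,/$) on complex numbers or an equality test between complex numbers, performed exactly. *)

(* Defs.v *)
From HB Require Import structures.
From mathcomp Require Import all_boot all_order all_algebra.
From mathcomp Require Import reals.
From mathcomp.real_closed Require Import complex.

Set Implicit Arguments.
Unset Strict Implicit.
Unset Printing Implicit Defensive.

Import Order.TTheory GRing.Theory Num.Theory.

Local Open Scope ring_scope.

Definition cauchy_points (F : fieldType) (m n : nat)
    (s : 'cV[F]_m) (t : 'cV[F]_n) : Prop :=
  forall i j, s i 0 - t j 0 != 0.

Definition cauchy_mx (F : fieldType) (m n : nat)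
    (s : 'cV[F]_m) (t : 'cV[F]_n) : 'M[F]_(m, n) :=
  \matrix_(i, j) (1 / (s i 0 - t j 0)).

Definition is_cauchy (F : fieldType) (m n : nat) (A : 'M[F]_(m, n)) : Prop :=
  exists (s : 'cV[F]_m) (t : 'cV[F]_n), cauchy_points s t /\ A = cauchy_mx s t.

Definition norm2 (C : numClosedFieldType) (k : nat) (v : 'cV[C]_k) : C :=
  sqrtC (\sum_i `|v i 0| ^+ 2).

Definition normalized_cauchy_points (C : numClosedFieldType) (m n : nat)
    (A : 'M[C]_(m, n)) (s : 'cV[C]_m) (t : 'cV[C]_n) : Prop :=
  [/\ cauchy_points s t, A = cauchy_mx s t &
      forall (s' : 'cV[C]_m) (t' : 'cV[C]_n),
        cauchy_points s' t' -> A = cauchy_mx s' t' ->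
        norm2 (col_mx s t) <= norm2 (col_mx s' t')].

(* Model of computation: for-loop programs over two-dimensional arrays of field
   elements (a vector is column 0 of an array, a scalar its cell (0,0)).  The
   programs are pure syntax, independent of the field and of the sizes m, n of
   the input matrix, so that field elements can only be inspected through the
   counted operations.  Loop counters and copies are free; each arithmetic
   operation and each equality test on field elements costs 1. *)

Inductive index : Type :=
| Rows
| Cols
| Lit of nat
| Idx of nat.

Inductive arith : Type := Add | Sub | Mul | Div.

Inductive expr : Type :=
| Nat of index
| Get of nat & index & index
| Op of arith & expr & expr.

Inductive cmd : Type :=
| Skip
| Set_ of nat & index & index & expr
| Seq of cmd & cmd
| IfEq of expr & expr & cmd & cmd
| For of nat & index & index & cmd. (* For v lo hi c : lo <= v < hi *)

Definition eval_index (m n : nat) (env : nat -> nat) (i : index) : nat :=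
  match i with
  | Rows => m
  | Cols => n
  | Lit k => k
  | Idx v => env v
  end.

Definition eval_arith (F : fieldType) (o : arith) (x y : F) : option F :=
  match o with
  | Add => Some (x + y)
  | Sub => Some (x - y)
  | Mul => Some (x * y)
  | Div => if y == 0 then None else Some (x / y)
  end.

(* Array name, row, column; None marks a cell that is not initialised. *)
Definition store (F : Type) : Type := nat -> nat -> nat -> option F.

Definition set_cell (F : Type) (st : store F) (x i j : nat) (a : F) : store F :=
  fun x' i' j' =>
    if [&& x' == x, i' == i & j' == j] then Some a else st x' i' j'.

Fixpoint eval_expr (F : fieldType) (m n : nat) (env : nat -> nat)
    (st : store F) (e : expr) : option F :=
  match e with
  | Nat i => Some (eval_index m n env i)%:R
  | Get x i j => st x (eval_index m n env i) (eval_index m n env j)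
  | Op o e1 e2 =>
      match eval_expr m n env st e1, eval_expr m n env st e2 with
      | Some a, Some b => eval_arith o a b
      | _, _ => None
      end
  end.

Fixpoint cost (e : expr) : nat :=
  match e with
  | Nat _ | Get _ _ _ => 0
  | Op _ e1 e2 => (cost e1 + cost e2).+1
  end.

(* The pair (st, k) is the current store and the number of operations performed
   so far; None means failure (division by 0, or reading an uninitialised
   cell). *)
Fixpoint exec (F : fieldType) (m n : nat) (env : nat -> nat) (c : cmd)
    (st : store F) (k : nat) : option (store F * nat) :=
  match c with
  | Skip => Some (st, k)
  | Set_ x i j e =>
      if eval_expr m n env st e is Some a then
        Some (set_cell st x (eval_index m n env i) (eval_index m n env j) a,
              (k + cost e)%N)
      else None
  | Seq c1 c2 =>
      if exec m n env c1 st k is Some (st', k') then exec m n env c2 st' k'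
      else None
  | IfEq e1 e2 c1 c2 =>
      match eval_expr m n env st e1, eval_expr m n env st e2 with
      | Some a, Some b =>
          exec m n env (if a == b then c1 else c2) st
            (k + cost e1 + cost e2).+1
      | _, _ => None
      end
  | For v lo hi body =>
      let l := eval_index m n env lo in
      let h := eval_index m n env hi in
      foldl
        (fun r i =>
           if r is Some (st', k') then
             exec m n (fun w => if w == v then i else env w) body st' k'
           else None)
        (Some (st, k)) (iota l (h - l))
  end.

(* Array 0 is the input matrix. *)
Definition init_store (F : Type) (m n : nat) (A : 'M[F]_(m, n)) : store F :=
  fun x i j =>
    if x is 0%N then
      match insub i, insub j with
      | Some i', Some j' => Some (A i' j')
      | _, _ => None
      end
    else None.

Definition run (F : fieldType) (m n : nat) (c : cmd) (A : 'M[F]_(m, n)) :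
    option (store F * nat) :=
  exec m n (fun=> 0%N) c (init_store A) 0.

Definition holds_vec (F : Type) (m : nat) (st : store F) (x : nat)
    (v : 'cV[F]_m) : Prop :=
  forall i : 'I_m, st x i 0%N = Some (v i 0).

Declare Scope prog_scope.
Delimit Scope prog_scope with prog.
Bind Scope prog_scope with expr cmd.
Notation "e1 + e2" := (Op Add e1 e2) : prog_scope.
Notation "e1 - e2" := (Op Sub e1 e2) : prog_scope.
Notation "e1 * e2" := (Op Mul e1 e2) : prog_scope.
Notation "e1 / e2" := (Op Div e1 e2) : prog_scope.
Notation "c1 ;; c2" := (Seq c1 c2) (at level 100, right associativity) :
  prog_scope.

Definition arr_a : nat := 0.
Definition arr_s : nat := 1.
Definition arr_t : nat := 2.
Definition arr_sum_s : nat := 3.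
Definition arr_sum_t : nat := 4.
Definition arr_alpha : nat := 5.
Definition arr_s_tilde : nat := 6.
Definition arr_t_tilde : nat := 7.

Definition getv (x : nat) (i : index) : expr := Get x i (Lit 0).
Definition setv (x : nat) (i : index) (e : expr) : cmd := Set_ x i (Lit 0) e.
Definition var_i : nat := 0.
Definition var_j : nat := 1.

(* Indices are 0-based: a_{1j} is cell (0, j) of arr_a. *)
Definition recovery : cmd := (
  setv arr_s (Lit 0) (Nat (Lit 0));;

  For var_j (Lit 0) Cols
    (setv arr_t (Idx var_j)
      (getv arr_s (Lit 0) - Nat (Lit 1) / Get arr_a (Lit 0) (Idx var_j)));;

  For var_i (Lit 1) Rows
    (setv arr_s (Idx var_i)
      (getv arr_t (Lit 0) + Nat (Lit 1) / Get arr_a (Idx var_i) (Lit 0)));;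

  setv arr_sum_s (Lit 0) (Nat (Lit 0));;
  For var_i (Lit 0) Rows
    (setv arr_sum_s (Lit 0) (getv arr_sum_s (Lit 0) + getv arr_s (Idx var_i)));;
  setv arr_sum_t (Lit 0) (Nat (Lit 0));;
  For var_j (Lit 0) Cols
    (setv arr_sum_t (Lit 0) (getv arr_sum_t (Lit 0) + getv arr_t (Idx var_j)));;
  setv arr_alpha (Lit 0)
    (Nat (Lit 1) / (Nat Rows + Nat Cols) *
      (getv arr_sum_s (Lit 0) + getv arr_sum_t (Lit 0)));;

  For var_i (Lit 0) Rows
    (setv arr_s_tilde (Idx var_i)
      (getv arr_s (Idx var_i) - getv arr_alpha (Lit 0)));;
  For var_j (Lit 0) Cols
    (setv arr_t_tilde (Idx var_j)
      (getv arr_t (Idx var_j) - getv arr_alpha (Lit 0)))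
  )%prog.

(* The answer of a decision program is 1 or 0, in cell (0,0) of array out. *)
Definition decides_in (F : fieldType) (m n : nat) (c : cmd) (out : nat)
    (P : 'M[F]_(m, n) -> Prop) (bound : nat) : Prop :=
  forall A : 'M[F]_(m, n), exists (st : store F) (k : nat),
    [/\ run c A = Some (st, k), (k <= bound)%N &
        (P A /\ st out 0%N 0%N = Some 1) \/
        (~ P A /\ st out 0%N 0%N = Some 0)].

(* Main.v *)
Require Import Defs.
From HB Require Import structures.
From mathcomp Require Import all_boot all_order all_algebra.
From mathcomp Require Import boolp reals.
From mathcomp.real_closed Require Import complex.
From mathcomp Require Import ring zify.

Set Implicit Arguments.
Unset Strict Implicit.
Unset Printing Implicit Defensive.

Import Order.TTheory GRing.Theory Num.Theory.

Local Open Scope ring_scope.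

(** Translating all coordinates of a pair (s, t) by the same constant changes
    no difference s_i - t_j, hence neither the Cauchy matrix C(s, t) nor the
    property of being Cauchy points.  Conversely the differences determine the
    pair up to such a translation: this is what the recovery algorithm
    exploits, since 1 / a_ij = s_i - t_j gives back s_i - s_1 and t_j - s_1
    from the first row and the first column.  Its last steps subtract the
    mean, which erases the translation: on C(s, t) the program stores the
    centred version of (s, t), whichever Cauchy points (s, t) of the matrix
    one starts from ([run_recovery]).  All Cauchy points of one matrix thus
    have the same centred version ([centred_cauchy_points_unique]), and
    subtracting the mean never increases the Euclidean norm
    ([norm2_centred]), so the output has minimal norm.

    For the decision problem, A is a Cauchy matrix exactly when its entries
    are nonzero and satisfy 1/a_ij = 1/a_iq - 1/a_pq + 1/a_pj for one fixed
    pivot (p, q).  Multiplying by the four entries removes the divisions and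
    leaves a test that is meaningful on arbitrary matrices and costs a bounded
    number of operations per entry ([is_cauchyP]).

    The programs are executed symbolically: [exec_for] reduces a loop to the
    sequence of stores it passes through, and every loop body used here costs
    the same number of operations at each iteration, so the counts are
    exact. *)

(** * Symbolic execution of loops *)

Section Loops.
Variables (F : fieldType) (m n : nat).
Implicit Types (st : store F) (env : nat -> nat).

Definition bind env (v i : nat) : nat -> nat :=
  fun w => if w == v then i else env w.

Lemma bind_same env v i : bind env v i v = i.
Proof. by rewrite /bind eqxx. Qed.

(** Rewriting with this equation executes the head of a program and leaves the
    later loops folded, which simplification would not. *)
Lemma exec_seq env c1 c2 st k st' k' :
  exec m n env c1 st k = Some (st', k') ->
  exec m n env (Seq c1 c2) st k = exec m n env c2 st' k'.
Proof. by move=> /= ->. Qed.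

(** The loop rule in equational form: [S i] is the store in which iteration [i]
    begins, and plays the part of a loop invariant.  A cost [c] independent of
    the iteration keeps the operation count an equality. *)
Lemma exec_for (S : nat -> store F) (c : nat) env v lo hi body st k
    (l := eval_index m n env lo) (h := eval_index m n env hi) :
  (l <= h)%N -> S l = st ->
  (forall i k', (l <= i < h)%N ->
     exec m n (bind env v i) body (S i) k' = Some (S i.+1, (k' + c)%N)) ->
  exec m n env (For v lo hi body) st k = Some (S h, (k + c * (h - l))%N).
Proof.
move=> lh <- step; rewrite /= -/l -/h.
move: (h - l)%N (subnK lh) => d; rewrite addnC => hE.
elim: d {lh} l k hE step => [|d IH] l k hE step /=.
  by rewrite muln0 addn0 -hE addn0.
rewrite [exec _ _ _ _ _ _]step; last by lia.
rewrite IH; first by rewrite mulnS addnA.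
  by rewrite -hE addSnnS.
by move=> i k' ?; apply: step; lia.
Qed.

Definition fill st (x l h : nat) (f : nat -> F) : store F :=
  fun y i j =>
    if [&& y == x, (l <= i < h)%N & j == 0%N] then Some (f i) else st y i j.

(** The expression [e] may read any array except the one that the loop writes,
    so its values do not depend on the progress of the loop. *)
Lemma exec_fill env v x lo hi e st k (f : nat -> F)
    (l := eval_index m n env lo) (h := eval_index m n env hi) :
  (l <= h)%N ->
  (forall i st', (l <= i < h)%N -> (forall y, y != x -> st' y = st y) ->
     eval_expr m n (bind env v i) st' e = Some (f i)) ->
  exec m n env (For v lo hi (setv x (Idx v) e)) st k =
    Some (fill st x l h f, (k + cost e * (h - l))%N).
Proof.
move=> lh ev; apply: (@exec_for (fill st x l ^~ f) (cost e)) => //.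
  apply/funext => y; apply/funext => i; apply/funext => j.
  by rewrite /fill; case: ifP => // /and3P[_]; lia.
move=> i k' li; rewrite /= (ev i) //; last first.
  by move=> y /negPf yx; rewrite /fill yx.
rewrite /bind eqxx; congr (Some (_, _)).
apply/funext => y; apply/funext => a; apply/funext => b.
rewrite /set_cell /fill ltnS (leq_eqVlt a i).
case: (y == x) => //=; case: (a =P i) => [->|_] /=; last by [].
by rewrite (proj1 (andP li)) ltnn andbF; case: ifP.
Qed.

Lemma set_cell_same st x i j a : set_cell st x i j a x i j = Some a.
Proof. by rewrite /set_cell !eqxx. Qed.

Lemma set_cell_other st x i j a y :
  y != x -> set_cell st x i j a y = st y.
Proof.
move=> /negPf yx; apply/funext => i'; apply/funext => j'.
by rewrite /set_cell yx.
Qed.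

Lemma fill_same st x l h f i :
  (l <= i < h)%N -> fill st x l h f x i 0%N = Some (f i).
Proof. by rewrite /fill eqxx => ->. Qed.

Lemma fill_other st x l h f y : y != x -> fill st x l h f y = st y.
Proof.
move=> /negPf yx; apply/funext => i'; apply/funext => j'.
by rewrite /fill yx.
Qed.

Lemma set_cell_twice st x i j a b :
  set_cell (set_cell st x i j a) x i j b = set_cell st x i j b.
Proof.
apply/funext => x'; apply/funext => i'; apply/funext => j'.
by rewrite /set_cell; case: [&& _, _ & _].
Qed.

(** The accumulator is required to be a [set_cell] of the initial store, which
    makes successive updates collapse and the final store again of this
    form. *)
Lemma exec_sum env v (x y : nat) hi st k (a : F) (f : nat -> F)
    (h := eval_index m n env hi) :
  x != y -> (forall i, (i < h)%N -> st y i 0%N = Some (f i)) ->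
  exec m n env
    (For v (Lit 0) hi (setv x (Lit 0) (getv x (Lit 0) + getv y (Idx v))%prog))
    (set_cell st x 0 0 a) k =
  Some (set_cell st x 0 0 (a + \sum_(i < h) f i), (k + h)%N).
Proof.
move=> xy sty.
pose S i := set_cell st x 0 0 (a + \sum_(j < i) f j).
have -> : (k + h = k + 1 * (h - 0))%N by rewrite mul1n subn0.
apply: (@exec_for S 1) => //.
  by rewrite /S big_ord0 addr0.
move=> i k' ih; rewrite /S /= /bind eqxx {1}/set_cell !eqxx /=.
rewrite {1}/set_cell eq_sym (negPf xy) /= sty //.
by rewrite set_cell_twice big_ord_recr /= addrA.
Qed.

Lemma init_storeE (A : 'M[F]_(m, n)) (i : 'I_m) (j : 'I_n) :
  init_store A 0 i j = Some (A i j).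
Proof. by rewrite /init_store !valK. Qed.

End Loops.

(** * Centred vectors *)

Definition mean (F : fieldType) (k : nat) (v : 'cV[F]_k) : F :=
  k%:R^-1 * \sum_i v i 0.

Definition centred (F : fieldType) (k : nat) (v : 'cV[F]_k) : 'cV[F]_k :=
  v - const_mx (mean v).

(** With mu the mean, the squared norm drops by exactly k |mu|^2: the constant
    vector mu is the orthogonal projection of v on the constant vectors. *)
Lemma norm2_centred (C : numClosedFieldType) (k : nat) (v : 'cV[C]_k) :
  norm2 (centred v) <= norm2 v.
Proof.
rewrite /norm2 ler_sqrtC ?qualifE /= ?sumr_ge0 // => [|i _|i _];
  try by rewrite exprn_ge0.
case: k v => [|k] v; first by rewrite !big_ord0.
set mu := mean v.
have sumE : \sum_i v i 0 = k.+1%:R * mu.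
  by rewrite /mu /mean mulVKf // pnatr_eq0.
have centredE i : centred v i 0 = v i 0 - mu by rewrite !mxE.
clearbody mu.
have -> : \sum_i `|centred v i 0| ^+ 2
        = \sum_i `|v i 0| ^+ 2 - k.+1%:R * `|mu| ^+ 2.
  under eq_bigr => i _ do
    rewrite centredE normCK rmorphB /= mulrBl !mulrBr -normCK.
  rewrite !sumrB -mulr_suml -mulr_sumr -rmorph_sum sumE rmorphM rmorph_nat.
  rewrite sumr_const card_ord -mulr_natl normCK /=; ring.
by rewrite lerBlDr lerDl mulr_ge0 ?ler0n ?exprn_ge0.
Qed.

(** * Cauchy points *)

Section CauchyPoints.
Variables (F : fieldType) (m n : nat).
Implicit Types (A : 'M[F]_(m, n)) (s : 'cV[F]_m) (t : 'cV[F]_n).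

Lemma cauchy_points_centred s t :
  let v := centred (col_mx s t) in
  cauchy_points s t ->
  cauchy_points (usubmx v) (dsubmx v) /\
  cauchy_mx (usubmx v) (dsubmx v) = cauchy_mx s t.
Proof.
move=> v st.
have dE i j : usubmx v i 0 - dsubmx v j 0 = s i 0 - t j 0.
  rewrite !mxE (unsplitK (inl i)) (unsplitK (inr j)); ring.
split=> [i j|]; first by rewrite dE st.
by apply/matrixP => i j; rewrite /cauchy_mx [LHS]mxE [RHS]mxE dE.
Qed.

(** The equation 1/a = 1/a_iq - 1/a_pq + 1/a_pj with denominators cleared.  The
    condition a != 0 is separate because the polynomial equation also holds
    when enough entries vanish, as in the zero matrix. *)
Definition cauchy_entry_test (a a_pq a_iq a_pj : F) : bool :=
  (a != 0) &&
  (a_pq * a_iq * a_pj == a * (a_pq * a_pj - a_iq * a_pj + a_pq * a_iq)).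

(** Sufficiency: s_i := 1/a_iq and t_j := 1/a_pq - 1/a_pj are Cauchy points of
    A, chosen so that t_q = 0; the test at (i, j) says precisely that
    s_i - t_j = 1/a_ij. *)
Lemma is_cauchyP (p : 'I_m) (q : 'I_n) A :
  is_cauchy A <-> forall i j, cauchy_entry_test (A i j) (A p q) (A i q) (A p j).
Proof.
split=> [[s [t [st ->]]] i j|ok].
  rewrite /cauchy_entry_test !mxE !div1r invr_eq0 st /=; apply/eqP.
  by field; rewrite !st.
have nz i j : A i j != 0 by case/andP: (ok i j).
have inv_diff i j : (A i q)^-1 - ((A p q)^-1 - (A p j)^-1) = (A i j)^-1.
  have /andP[_ /eqP eq_ij] := ok i j; apply: (mulfI (nz i j)).
  rewrite divff //; apply: (mulIf
    (mulf_neq0 (mulf_neq0 (nz p q) (nz i q)) (nz p j))).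
  by rewrite mul1r [RHS]eq_ij; field; rewrite !nz.
exists (\col_i (A i q)^-1), (\col_j ((A p q)^-1 - (A p j)^-1)).
split=> [i j|]; first by rewrite !mxE inv_diff invr_eq0.
by apply/matrixP => i j; rewrite !mxE inv_diff div1r invrK.
Qed.

End CauchyPoints.

(** * The recovery program *)

(** The algorithm fixes its free translation by the choice s_1 = 0, so before
    centring it has stored s_i - s_1 and t_j - s_1 ([f] and [g] below).  Their
    mean is the mean of (s, t) minus s_1, and s_1 cancels in the output. *)
Lemma run_recovery (F : fieldType) (m n : nat) (s : 'cV[F]_m.+1)
    (t : 'cV[F]_n.+1) :
  let v := centred (col_mx s t) in
  (m.+1 + n.+1)%:R != 0 :> F -> cauchy_points s t ->
  exists st,
    [/\ run recovery (cauchy_mx s t) = Some (st, (4 * (m.+1 + n.+1) + 2)%N),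
        holds_vec st arr_s_tilde (usubmx v) &
        holds_vec st arr_t_tilde (dsubmx v)].
Proof.
move=> v mn0 st.
pose f i : F := s (inord i) 0 - s 0 0.
pose g j : F := t (inord j) 0 - s 0 0.
have aE i j : (i < m.+1)%N -> (j < n.+1)%N ->
    init_store (cauchy_mx s t) 0 i j =
    Some (s (inord i) 0 - t (inord j) 0)^-1.
  move=> im jn.
  by rewrite -{1}(inordK im) -{1}(inordK jn) init_storeE mxE div1r.
have fE : \sum_(i < m.+1) f i = \sum_i s i 0 - m.+1%:R * s 0 0.
  rewrite sumrB sumr_const card_ord mulr_natl.
  by under eq_bigr => i _ do rewrite inord_val.
have gE : \sum_(j < n.+1) g j = \sum_j t j 0 - n.+1%:R * s 0 0.
  rewrite sumrB sumr_const card_ord mulr_natl.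
  by under eq_bigr => i _ do rewrite inord_val.
pose alpha : F := 1 / (m.+1%:R + n.+1%:R)
      * (\sum_(i < m.+1) f i + \sum_(j < n.+1) g j).
have alphaE : alpha = mean (col_mx s t) - s 0 0.
  rewrite /alpha fE gE /mean big_split_ord /=.
  under [X in _ = _ * (X + _) - _]eq_bigr => i _ do rewrite col_mxEu.
  under [X in _ = _ * (_ + X) - _]eq_bigr => i _ do rewrite col_mxEd.
  rewrite !natrD in mn0 *; move: (m.+1%:R : F) (n.+1%:R : F) mn0 => M N mn0.
  field; exact: mn0.
have f0 : f 0%N = 0 by rewrite /f (inord_val ord0) subrr.
set st0 := init_store _ in aE *.
(* The stores reached after each assignment or loop of the program. *)
pose st1 := set_cell st0 arr_s 0 0 0.
pose st2 := fill st1 arr_t 0 n.+1 g.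
pose st3 := fill st2 arr_s 1 m.+1 f.
pose st4 := set_cell st3 arr_sum_s 0 0 (0 + \sum_(i < m.+1) f i).
pose st5 := set_cell st4 arr_sum_t 0 0 (0 + \sum_(j < n.+1) g j).
pose st6 := set_cell st5 arr_alpha 0 0 alpha.
pose st7 := fill st6 arr_s_tilde 0 m.+1 (fun i => f i - alpha).
pose st8 := fill st7 arr_t_tilde 0 n.+1 (fun j => g j - alpha).
(* Cell 0 lies outside the range of the loop that fills arr_s; it holds the
   initial 0, which is the value of f there. *)
have st3s i : (i < m.+1)%N -> st3 arr_s i 0%N = Some (f i).
  move=> im; rewrite /st3 /fill im /= andbT; case: i im => [|i] //= _.
  by rewrite f0.
have st3t j : (j < n.+1)%N -> st3 arr_t j 0%N = Some (g j).
  by move=> jn; rewrite /st3 /fill /= /st2 /fill /= jn.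
exists st8; split.
- rewrite /run /recovery -/st0 (@exec_seq _ _ _ _ _ _ _ _ st1 0%N) //.
  rewrite (exec_seq (st' := st2) (k' := 2 * n.+1) _); last first.
    rewrite -[n.+1 in RHS]subn0; apply: exec_fill => // j st' /= jn st'E.
    rewrite bind_same !st'E // /st1 set_cell_same set_cell_other // aE //=.
    rewrite invr_eq0 (inord_val ord0) (negPf (st _ _)) /= div1r invrK.
    by rewrite /g sub0r opprB.
  rewrite (exec_seq (st' := st3) (k' := 2 * n.+1 + 2 * m) _); last first.
    have -> : (2 * m = 2 * (m.+1 - 1))%N by rewrite subn1.
    apply: exec_fill => // i st' /= /andP[_ im] st'E.
    rewrite bind_same !st'E // /st2 fill_same // fill_other // /st1.
    rewrite set_cell_other // aE //= invr_eq0 (negPf (st _ _)) /=.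
    by rewrite div1r invrK /f /g addrC subrKA.
  rewrite (exec_seq (st' := set_cell st3 arr_sum_s 0 0 0)
     (k' := 2 * n.+1 + 2 * m) _); last by rewrite /= addn0.
  rewrite (exec_seq (st' := st4) (k' := 2 * n.+1 + 2 * m + m.+1) _); last first.
    exact: exec_sum.
  rewrite (exec_seq (st' := set_cell st4 arr_sum_t 0 0 0)
     (k' := 2 * n.+1 + 2 * m + m.+1) _); last by rewrite /= addn0.
  rewrite (exec_seq (st' := st5)
     (k' := 2 * n.+1 + 2 * m + m.+1 + n.+1) _); last first.
    exact: exec_sum.
  rewrite (exec_seq (st' := st6)
     (k' := 2 * n.+1 + 2 * m + m.+1 + n.+1 + 4) _); last first.
    by rewrite /= -natrD (negPf mn0) !add0r natrD.
  rewrite (exec_seq (st' := st7)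
     (k' := 2 * n.+1 + 2 * m + m.+1 + n.+1 + 4 + 1 * m.+1) _); last first.
    rewrite -[m.+1 in RHS]subn0; apply: exec_fill => // i st' /= im st'E.
    rewrite bind_same !st'E // /st6 set_cell_same.
    by rewrite /st5 /st4 !set_cell_other // st3s.
  have -> : (4 * (m.+1 + n.+1) + 2 =
     2 * n.+1 + 2 * m + m.+1 + n.+1 + 4 + 1 * m.+1 + 1 * (n.+1 - 0))%N by lia.
  apply: exec_fill => // j st' /= jn st'E.
  rewrite bind_same !st'E // /st7 !fill_other // /st6 set_cell_same.
  by rewrite /st5 /st4 !set_cell_other // st3t.
- move=> i; rewrite /st8 fill_other // /st7 fill_same //=.
  rewrite alphaE /f inord_val !mxE (unsplitK (inl i)).
  by rewrite opprB addrA subrK.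
- move=> j; rewrite /st8 fill_same //=.
  rewrite alphaE /g inord_val !mxE (unsplitK (inr j)).
  by rewrite opprB addrA subrK.
Qed.

(** Executions are deterministic and the final store holds the centred version
    of both pairs. *)
Lemma centred_cauchy_points_unique (F : fieldType) (m n : nat)
    (s s' : 'cV[F]_m.+1) (t t' : 'cV[F]_n.+1) :
  (m.+1 + n.+1)%:R != 0 :> F -> cauchy_points s t -> cauchy_points s' t' ->
  cauchy_mx s t = cauchy_mx s' t' ->
  centred (col_mx s t) = centred (col_mx s' t').
Proof.
move=> mn0 st st' eqA.
have [r [runE sE tE]] := run_recovery mn0 st.
have [r' [runE' sE' tE']] := run_recovery mn0 st'.
move: runE'; rewrite -eqA runE => -[rE]; rewrite -{}rE in sE' tE'.
rewrite -[LHS]vsubmxK -[RHS]vsubmxK; congr (col_mx _ _); apply/colP => i.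
  exact: Some_inj (etrans (esym (sE i)) (sE' i)).
exact: Some_inj (etrans (esym (tE i)) (tE' i)).
Qed.

(** * The decision program *)

Definition arr_answer : nat := 1.

(** The pivot is the corner entry.  Both tests of an entry are carried out even
    when the first one fails, so that every entry costs exactly 10 operations;
    without divisions no execution fails, whatever the matrix. *)
Definition decide_cauchy : cmd :=
  let a := Get arr_a (Idx var_i) (Idx var_j) in
  let a_00 := Get arr_a (Lit 0) (Lit 0) in
  let a_i0 := Get arr_a (Idx var_i) (Lit 0) in
  let a_0j := Get arr_a (Lit 0) (Idx var_j) in
  let reject := setv arr_answer (Lit 0) (Nat (Lit 0)) in
  (setv arr_answer (Lit 0) (Nat (Lit 1));;
   For var_i (Lit 0) Rows
     (For var_j (Lit 0) Cols
        (IfEq a (Nat (Lit 0)) reject Skip;;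
         IfEq (a_00 * a_i0 * a_0j)
           (a * (a_00 * a_0j - a_i0 * a_0j + a_00 * a_i0)) Skip reject)))%prog.

(** The answer cell always holds a boolean cast to the field, the conjunction of
    the tests done so far; no other cell changes. *)
Lemma run_decide_cauchy (F : fieldType) (m n : nat) (A : 'M[F]_(m.+1, n.+1)) :
  exists st,
    run decide_cauchy A = Some (st, (10 * (m.+1 * n.+1))%N) /\
    st arr_answer 0%N 0%N =
      Some [forall i, forall j,
              cauchy_entry_test (A i j) (A 0 0) (A i 0) (A 0 j)]%:R.
Proof.
pose test i j :=
  cauchy_entry_test (A (inord i) (inord j)) (A 0 0) (A (inord i) 0)
    (A 0 (inord j)).
pose answer (b : bool) := set_cell (init_store A) arr_answer 0 0 b%:R.
have aE b i j : (i < m.+1)%N -> (j < n.+1)%N ->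
    answer b arr_a i j = Some (A (inord i) (inord j)).
  move=> im jn; rewrite /answer set_cell_other //.
  by rewrite -{1}(inordK im) -{1}(inordK jn) init_storeE.
have rejectE b : set_cell (answer b) arr_answer 0 0 0 = answer false.
  exact: set_cell_twice.
pose row i := all (test i) (iota 0 n.+1).
exists (answer (all row (iota 0 m.+1))); split; last first.
  rewrite /answer set_cell_same; congr (Some (nat_of_bool _)%:R); apply/idP/idP.
    move=> /allP ok; apply/forallP => i; apply/forallP => j.
    have /ok/allP/(_ j) : (i : nat) \in iota 0 m.+1.
      by rewrite mem_iota ltn_ord.
    by rewrite mem_iota ltn_ord /test !inord_val; apply.
  move=> /forallP ok; apply/allP => i _; apply/allP => j _.
  exact: (forallP (ok (inord i)) (inord j)).
rewrite /run /decide_cauchy (exec_seq (st' := answer true) (k' := 0) _) //.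
have -> : (10 * (m.+1 * n.+1) = 0 + (10 * n.+1) * (m.+1 - 0))%N by lia.
apply: (@exec_for _ _ _ (fun i => answer (all row (iota 0 i)))) => //.
move=> i k /andP[_ im]; rewrite -[in RHS]addn1 iotaD all_cat all_seq1.
have -> : (10 * n.+1 = 10 * (n.+1 - 0))%N by lia.
set b := all row (iota 0 i).
apply: (@exec_for _ _ _
  (fun j => answer (b && all (test i) (iota 0 j)))) => //.
  by rewrite andbT.
move=> j k' /andP[_ jn]; rewrite -[in RHS]addn1 iotaD all_cat all_seq1 andbA.
rewrite add0n /test /cauchy_entry_test.
set b' := b && _; set a := A _ _.
set env := bind (bind _ _ _) _ _.
have envE : (env var_i = i) * (env var_j = j) by [].
have inord0 k'' : inord 0 = 0 :> 'I_k''.+1 by apply/val_inj; rewrite /= inordK.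
rewrite (exec_seq (st' := answer (b' && (a != 0))) (k' := k'.+1) _); last first.
  rewrite /= !envE aE // -/a !addn0.
  by case: (a == 0); rewrite /= ?addn0 ?rejectE ?andbF ?andbT.
rewrite /= !envE !aE // !inord0 -/a andbA.
by case: (_ == _); rewrite /= ?rejectE ?andbF ?andbT;
  congr (Some (_, _)); lia.
Qed.

Theorem theorem2p4 (R : realType) :
  (exists K : nat,
     forall (m n : nat) (A : 'M[R[i]]_(m, n)),
       (1 <= m)%N -> (1 <= n)%N -> is_cauchy A ->
       exists (st : store R[i]) (k : nat) (s : 'cV[R[i]]_m) (t : 'cV[R[i]]_n),
         [/\ run recovery A = Some (st, k),
             holds_vec st arr_s_tilde s /\ holds_vec st arr_t_tilde t,
             normalized_cauchy_points A s t,
             A = cauchy_mx s t &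
             (k <= K * (m + n))%N]) /\
  (exists (D : cmd) (out K : nat),
     forall m n : nat, (1 <= m)%N -> (1 <= n)%N ->
       decides_in D out (fun A : 'M[R[i]]_(m, n) => is_cauchy A) (K * (m * n))).
Proof.
split.
  exists 5%N => [[|m] // [|n] // A _ _ [s [t [st AE]]]].
  have mn0 : (m.+1 + n.+1)%:R != 0 :> R[i] by rewrite pnatr_eq0.
  have [st' [run' s' t']] := run_recovery mn0 st.
  have [st'' AE'] := cauchy_points_centred st; rewrite -AE in AE' run'.
  exists st', (4 * (m.+1 + n.+1) + 2)%N.
  exists (usubmx (centred (col_mx s t))), (dsubmx (centred (col_mx s t))).
  split; [exact: run' | by split | | by [] | by lia].
  split; [exact: st'' | exact: esym | move=> s1 t1 st1 AE1].
  rewrite (centred_cauchy_points_unique mn0 st st1 (etrans (esym AE) AE1)).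
  rewrite vsubmxK; exact: norm2_centred.
exists decide_cauchy, arr_answer, 10%N => [[|m] // [|n] // _ _ A].
have [st [runE ansE]] := run_decide_cauchy A; exists st, (10 * (m.+1 * n.+1))%N.
split=> //; rewrite ansE; case: forallP => ok; [left | right]; split=> //.
  by apply/(is_cauchyP 0 0) => i j; apply/forallP: j; apply: ok.
by move=> /(is_cauchyP 0 0) ok'; case: ok => i; apply/forallP.
Qed.
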